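(* Let $R$ be a commutative valuation ring with infinite residue field $k$, and $f:A=\prod_{i\in I} A_i\to B$ a surjective homomorphism from a direct product of $R$-algebras to an $R$-algebra $B$ which is torsion-free as an $R$-module. Write $\mathrm{rk}_R(B)$ for the rank of $B$ as an $R$-module, i.e., the common cardinality of all maximal $R$-linearly independent subsets of $B$. Suppose that either (i) $\mathrm{rk}_R(B)<\mathrm{card}(k)$, or (ii) $\mathrm{rk}_R(B)<2^{\aleph_0}$. Then the composite homomorphism $A\to B\to B/Z(B)$ (of $f$ with the quotient map) can be factored $$A\ \to\ A/\mathcal{U}_0\times\dots\times A/\mathcal{U}_{n-1}\ \to\ B/Z(B)$$ for some $n\in\omega$, where the first map is the product of the quotient maps and the $\mathcal{U}_m$ are ultrafilters on $I$, which are $\mathrm{card}(k)^+$-complete in case (i), and countably complete in case (ii). Thus, if $\mathrm{card}(I)$ is less than every measurable cardinal $>\mathrm{card}(k)$ in case (i), or less than every uncountable measurable cardinal in case (ii), then the composite $A\to B\to B/Z(B)$ factors through the projection of $A$ to the product of finitely many of the $A_i$, and $f:A\to B$ can be written as the sum of a homomorphism $f_1:A\to B$ that factors through the projection of $A$ to the product of these finitely many $A_i$, and a homomorphism $f_0:A\to Z(B)$.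
   Context: For a commutative (associative unital) ring $R$, an $R$-algebra means an $R$-module $A$ with an $R$-bilinear multiplication $A\times A\to A$, not assumed associative, commutative, or unital; homomorphisms are $R$-algebra homomorphisms. For an algebra $B$, the total annihilator ideal is $Z(B)=\{x\in B\mid xB=Bx=\{0\}\}$. For a filter $\mathcal{U}$ on $I$, $A/\mathcal{U}$ denotes the reduced product: the quotient of $\prod_{i\in I} A_i$ by the relation $(a_i)\sim(b_i)$ iff $\{i\mid a_i=b_i\}\in\mathcal{U}$, with induced algebra structure. An ultrafilter on $I$ is a maximal proper filter of subsets of $I$; it is principal if it has the form $\{J\subseteq I\mid i_0\in J\}$. A filter is $\kappa$-complete ($\kappa$ an infinite cardinal) if it is closed under intersections of families of $<\kappa$ members, and countably complete if it is $\aleph_1$-complete. $\mathrm{card}(k)^+$ is the successor cardinal of $\mathrm{card}(k)$. An infinite cardinal $\mu$ is measurable if there exists a nonprincipal $\mu$-complete ultrafilter on $\mu$ (so $\aleph_0$ counts as measurable). A field is regarded as a valuation ring with trivial value group. *)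

(* Defs.v *)
From HB Require Import structures.
From mathcomp Require Import all_boot all_order all_algebra.
From mathcomp Require Import ring_quotient sesquilinear.
From mathcomp Require Import mathcomp_extra boolp classical_sets functions.
From mathcomp Require Import cardinality filter.

Set Implicit Arguments.
Unset Strict Implicit.
Unset Printing Implicit Defensive.

Import GRing.Theory.
Local Open Scope classical_set_scope.
Local Open Scope card_scope.
Local Open Scope ring_scope.
Local Open Scope quotient_scope.

(* A cardinal is represented by any type having it as cardinality.  The alias
   fixes one universe for all cardinals, so that in [below_measurables] the
   bound variable [M] ranges over a universe containing [I] and [K]. *)
Definition cardinal := Type.

Definition card_lt T U (X : set T) (Y : set U) : bool :=
  (X #<= Y) && ~~ (Y #<= X).
Notation "X '#<' Y" := (card_lt X Y) (at level 79) : card_scope.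

Definition card_complete I (K : cardinal) (U : set_system I) : Prop :=
  forall S : set (set I), S `<=` U -> S #< [set: K] -> U (\bigcap_(J in S) J).

(* [card(K)^+]-completeness: fewer than [card(K)^+] members means at most
   [card(K)] members.  Countable completeness is the case [K := nat]. *)
Definition succ_complete I (K : cardinal) (U : set_system I) : Prop :=
  forall S : set (set I), S `<=` U -> S #<= [set: K] -> U (\bigcap_(J in S) J).

Definition principal I (U : set_system I) : Prop :=
  exists i0, U = [set J | J i0].

(* No uncountability is required: [nat] is measurable. *)
Definition measurable_cardinal (M : cardinal) : Prop :=
  infinite_set [set: M] /\
  exists U : set_system M,
    [/\ UltraFilter U, ~ principal U & card_complete M U].

Definition below_measurables (I K : cardinal) : Prop :=
  forall M : cardinal, measurable_cardinal M ->
    [set: K] #< [set: M] -> [set: I] #< [set: M].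

HB.mixin Record isValuationRing R of GRing.IntegralDomain R := {
  dvdr_total : forall x y : R, (exists z, y = z * x) \/ (exists z, x = z * y)
}.

#[short(type="valRingType")]
HB.structure Definition ValuationRing :=
  {R of GRing.IntegralDomain R & isValuationRing R}.

Definition max_ideal (R : valRingType) : {pred R} :=
  [pred x | x \isn't a GRing.unit].

Lemma max_ideal_closed (R : valRingType) : idealr_closed (@max_ideal R).
Proof.
have sM a x : x \in @max_ideal R -> a * x \in @max_ideal R.
  by rewrite !inE unitrM negb_and => ->; rewrite orbT.
have sD x y : x \in @max_ideal R -> y \in @max_ideal R ->
    x + y \in @max_ideal R.
  move=> xm ym; case: (dvdr_total x y) => -[z e].
    by rewrite e -[X in X + _]mul1r -mulrDl sM.
  by rewrite e -[X in _ + X]mul1r -mulrDl sM.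
split=> [||a x y xm ym]; rewrite ?inE ?unitr0 ?unitr1 //.
exact/sD/ym/sM.
Qed.

HB.instance Definition _ (R : valRingType) :=
  isIdealr.Build R (@max_ideal R) (@max_ideal_closed R).

Definition residue_field (R : valRingType) := {ideal_quot @max_ideal R}.

HB.instance Definition _ (R : valRingType) :=
  GRing.ComNzRing.on (residue_field R).

Lemma residue_field_inv (R : valRingType) (x : residue_field R) :
  x != 0 -> exists y, y * x = 1.
Proof.
rewrite -[x]reprK => x0; set r : R := repr x in x0 *.
exists (\pi_({ideal_quot @max_ideal R}) r^-1).
have ur : r \is a GRing.unit.
  apply: contraNT x0 => nr.
  by rewrite -(@pi_zeror _ _ _ _ _ {ideal_quot @max_ideal R}) piE
    Quotient.equivE subr0.
have := @pi_mulr _ _ _ _ _ _ _ {ideal_quot @max_ideal R} r^-1 r.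
rewrite mulVr // => e; apply: etrans (esym e) _.
exact: pi_oner.
Qed.

Section Rank.
Variables (R : comNzRingType) (V : lmodType R).

Definition torsion_free : Prop :=
  forall (r : R) (x : V), r *: x = 0 -> r = 0 \/ x = 0.

Definition lin_indep (X : set V) : Prop :=
  forall (s : seq V) (c : V -> R), uniq s -> (forall v, v \in s -> X v) ->
    \sum_(v <- s) c v *: v = 0 -> forall v, v \in s -> c v = 0.

Definition max_lin_indep (X : set V) : Prop :=
  lin_indep X /\ forall Y : set V, X `<` Y -> ~ lin_indep Y.

Lemma max_lin_indep_exists : exists X, max_lin_indep X.
Proof.
apply: (@Zorn_bigcup V lin_indep) => F FP Ftot s c us sX sum0 v vs.
suff [X FX sX'] : exists2 X, F X & forall v, v \in s -> X v.
  exact: (FP X FX s c us).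
have [X0 FX0 _] := sX v vs.
elim: s {us sum0 v vs} sX => [|a s IHs] sX; first by exists X0.
have [|X FX sX'] := IHs; first by move=> v vs; apply: sX; rewrite inE vs orbT.
have [Y FY Ya] := sX a (mem_head _ _).
case: (Ftot X Y FX FY) => XY.
- by exists Y => // v; rewrite inE => /orP[/eqP->//|/sX'/XY].
- by exists X => // v; rewrite inE => /orP[/eqP->|/sX'//]; exact: XY.
Qed.

(* A chosen maximal linearly independent subset: its cardinality is the rank,
   as all such subsets are equipotent when [R] is an integral domain. *)
Definition rank_set : set V := sval (cid max_lin_indep_exists).

End Rank.

Arguments torsion_free {R} V.
Arguments rank_set {R} V.

HB.mixin Record Lmodule_isNAlg (R : comNzRingType) A of GRing.Lmodule R A := {
  amul : A -> A -> A;
  amul_bilinear : bilinear_for *:%R *:%R amul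
}.

#[short(type="nalgType")]
HB.structure Definition NAlg (R : comNzRingType) :=
  {A of GRing.Lmodule R A & Lmodule_isNAlg R A}.

HB.mixin Record isAmulMorphism (R : comNzRingType) (A B : nalgType R)
    (f : A -> B) := {
  amul_morph : {morph f : x y / amul x y}
}.

#[short(type="nalgHom")]
HB.structure Definition NAlgHom (R : comNzRingType) (A B : nalgType R) :=
  {f of isAmulMorphism R A B f & @GRing.Linear R A B *:%R f}.

Section NAlgTheory.
Variables (R : comNzRingType) (A : nalgType R).
Implicit Types x y z : A.

Lemma amulBl x y z : amul (x - y) z = amul x z - amul y z.
Proof. exact: (zmod_morphism_linear ((@amul_bilinear R A).1 z)). Qed.

Lemma amulBr x y z : amul x (y - z) = amul x y - amul x z.
Proof. exact: (zmod_morphism_linear ((@amul_bilinear R A).2 x)). Qed.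

Lemma amul0x x : amul 0 x = 0.
Proof. by have := amulBl 0 0 x; rewrite !subrr. Qed.

Lemma amulx0 x : amul x 0 = 0.
Proof. by have := amulBr x 0 0; rewrite !subrr. Qed.

Lemma amulPl (a : R) x y z : amul (a *: x + y) z = a *: amul x z + amul y z.
Proof. exact: ((@amul_bilinear R A).1 z). Qed.

Lemma amulPr (a : R) x y z : amul x (a *: y + z) = a *: amul x y + amul x z.
Proof. exact: ((@amul_bilinear R A).2 x). Qed.

End NAlgTheory.

Definition aprod (R : comNzRingType) I (A : I -> nalgType R) : Type :=
  forall i, A i.

Section Product.
Variables (R : comNzRingType) (I : Type) (A : I -> nalgType R).
Local Notation P := (aprod A).
Implicit Types x y z : P.

HB.instance Definition _ := gen_eqMixin P.
HB.instance Definition _ := gen_choiceMixin P.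

Let zero : P := fun=> 0.
Let opp x : P := fun i => - x i.
Let add x y : P := fun i => x i + y i.

Let addA : associative add.
Proof. by move=> x y z; apply: functional_extensionality_dep => i; exact: addrA. Qed.
Let addC : commutative add.
Proof. by move=> x y; apply: functional_extensionality_dep => i; exact: addrC. Qed.
Let add0 : left_id zero add.
Proof. by move=> x; apply: functional_extensionality_dep => i; exact: add0r. Qed.
Let addN : left_inverse zero opp add.
Proof. by move=> x; apply: functional_extensionality_dep => i; exact: addNr. Qed.
HB.instance Definition _ := GRing.isZmodule.Build P addA addC add0 addN.

Let scale (a : R) x : P := fun i => a *: x i.
Let scaleA a b x : scale a (scale b x) = scale (a * b) x.
Proof. by apply: functional_extensionality_dep => i; exact: scalerA. Qed.
Let scale1 : left_id 1 scale.
Proof. by move=> x; apply: functional_extensionality_dep => i; exact: scale1r. Qed.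
Let scaleDr : right_distributive scale +%R.
Proof. by move=> a x y; apply: functional_extensionality_dep => i; exact: scalerDr. Qed.
Let scaleDl x : {morph scale^~ x : a b / a + b}.
Proof. by move=> a b; apply: functional_extensionality_dep => i; exact: scalerDl. Qed.
HB.instance Definition _ :=
  GRing.Zmodule_isLmodule.Build R P scaleA scale1 scaleDr scaleDl.

Let mul x y : P := fun i => amul (x i) (y i).
Let mul_bilinear : bilinear_for *:%R *:%R mul.
Proof.
split=> z a x y; apply: functional_extensionality_dep => i;
  [exact: amulPl | exact: amulPr].
Qed.
HB.instance Definition _ := Lmodule_isNAlg.Build R P mul_bilinear.

End Product.

HB.mixin Record isAmulIdeal (R : comNzRingType) (A : nalgType R)
    (J : A -> bool) := {
  ideal_scale : forall (a : R), {in J, forall x, a *: x \in J};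
  ideal_amull : forall y, {in J, forall x, amul y x \in J};
  ideal_amulr : forall y, {in J, forall x, amul x y \in J}
}.

#[short(type="nalgIdeal")]
HB.structure Definition NAlgIdeal (R : comNzRingType) (A : nalgType R) :=
  {J of GRing.ZmodClosed A J & isAmulIdeal R A J}.

(* The additive quotient of the library, with the structure induced by [A]. *)
Definition nalg_quot (R : comNzRingType) (A : nalgType R) (J : nalgIdeal A) :=
  Quotient.quot J.

Section NAlgQuotient.
Variables (R : comNzRingType) (A : nalgType R) (J : nalgIdeal A).
Local Notation Q := (nalg_quot J).

HB.instance Definition _ := GRing.Zmodule.on Q.
HB.instance Definition _ : EqQuotient A (Quotient.equiv J) Q := EqQuotient.on Q.

Definition nalg_proj (x : A) : Q := \pi_Q x.

Lemma nalg_projP x y : nalg_proj x = nalg_proj y <-> x - y \in J.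
Proof. by rewrite -Quotient.equivE; split=> [/eqP|h]; [|apply/eqP]; rewrite piE. Qed.

Lemma nalg_projK (q : Q) : nalg_proj (repr q) = q.
Proof. exact: reprK. Qed.

Lemma nalg_projD x y : nalg_proj (x + y) = nalg_proj x + nalg_proj y.
Proof. exact: Quotient.pi_add. Qed.

Let scale (a : R) (q : Q) : Q := nalg_proj (a *: repr q).
Let mul (p q : Q) : Q := nalg_proj (amul (repr p) (repr q)).

Let repr_proj x : repr (nalg_proj x) - x \in J.
Proof. by apply/nalg_projP; rewrite nalg_projK. Qed.

Let scaleE a x : scale a (nalg_proj x) = nalg_proj (a *: x).
Proof. by apply/nalg_projP; rewrite -scalerBr ideal_scale. Qed.

Let mulE x y : mul (nalg_proj x) (nalg_proj y) = nalg_proj (amul x y).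
Proof.
apply/nalg_projP; set x' := repr _; set y' := repr _.
rewrite -[amul x' y'](subrK (amul x y')) -addrA -amulBl -amulBr.
by apply: rpredD; [apply: ideal_amulr | apply: ideal_amull]; exact: repr_proj.
Qed.

Let scaleA a b q : scale a (scale b q) = scale (a * b) q.
Proof. by rewrite -[q]nalg_projK !scaleE scalerA. Qed.
Let scale1 : left_id 1 scale.
Proof. by move=> q; rewrite -[q]nalg_projK !scaleE scale1r. Qed.
Let scaleDr : right_distributive scale +%R.
Proof.
move=> a p q; rewrite -[p]nalg_projK -[q]nalg_projK -nalg_projD !scaleE.
by rewrite scalerDr nalg_projD.
Qed.
Let scaleDl q : {morph scale^~ q : a b / a + b}.
Proof. by move=> a b; rewrite -[q]nalg_projK !scaleE scalerDl nalg_projD. Qed.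
HB.instance Definition _ :=
  GRing.Zmodule_isLmodule.Build R Q scaleA scale1 scaleDr scaleDl.

Lemma nalg_projZ a x : nalg_proj (a *: x) = a *: nalg_proj x.
Proof. by rewrite -scaleE. Qed.

Let mul_bilinear : bilinear_for *:%R *:%R mul.
Proof.
split=> r a p q; rewrite -[p]nalg_projK -[q]nalg_projK -[r]nalg_projK /=.
  by rewrite -nalg_projZ -nalg_projD !mulE -nalg_projZ -nalg_projD amulPl.
by rewrite -nalg_projZ -nalg_projD !mulE -nalg_projZ -nalg_projD amulPr.
Qed.
HB.instance Definition _ := Lmodule_isNAlg.Build R Q mul_bilinear.

Lemma nalg_proj_linear : linear nalg_proj.
Proof. by move=> a x y; rewrite nalg_projD nalg_projZ. Qed.
Lemma nalg_proj_amul : {morph nalg_proj : x y / amul x y}.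
Proof. by move=> x y; rewrite -mulE. Qed.
HB.instance Definition _ :=
  GRing.isLinear.Build R A Q *:%R nalg_proj nalg_proj_linear.
HB.instance Definition _ := isAmulMorphism.Build R A Q nalg_proj nalg_proj_amul.

End NAlgQuotient.

Section TotalAnnihilator.
Variables (R : comNzRingType) (B : nalgType R).

Definition total_ann : {pred B} :=
  [pred x | `[< forall y : B, amul x y = 0 /\ amul y x = 0 >]].

Lemma total_ann_zmod_closed : zmod_closed total_ann.
Proof.
split=> [|x y /asboolP xZ /asboolP yZ]; apply/asboolP => z.
  by rewrite amul0x amulx0.
have [xz zx] := xZ z; have [yz zy] := yZ z.
by rewrite amulBl amulBr xz zx yz zy subrr.
Qed.
HB.instance Definition _ :=
  GRing.isZmodClosed.Build B total_ann total_ann_zmod_closed.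

Let annZ (a : R) : {in total_ann, forall x, a *: x \in total_ann}.
Proof.
move=> x /asboolP xZ; apply/asboolP => z; have [xz zx] := xZ z.
have := amulPl a x 0 z; have := amulPr a z x 0.
by rewrite !addr0 xz zx scaler0 amul0x amulx0 add0r.
Qed.
Let annl y : {in total_ann, forall x, amul y x \in total_ann}.
Proof.
move=> x /asboolP xZ; apply/asboolP => z.
by rewrite (xZ y).2 amul0x amulx0.
Qed.
Let annr y : {in total_ann, forall x, amul x y \in total_ann}.
Proof.
move=> x /asboolP xZ; apply/asboolP => z.
by rewrite (xZ y).1 amul0x amulx0.
Qed.
HB.instance Definition _ := isAmulIdeal.Build R B total_ann annZ annl annr.

End TotalAnnihilator.

Arguments total_ann {R} B.

Section ReducedProduct.
Variables (R : comNzRingType) (I : Type) (A : I -> nalgType R).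
Variable F : filter_on I.
Local Notation P := (aprod A).

Definition null_mod : {pred P} := [pred x : P | `[< filter F [set i | x i = 0] >]].

Lemma null_mod_zmod_closed : zmod_closed null_mod.
Proof.
split=> [|x y /asboolP xN /asboolP yN]; apply/asboolP.
  by apply: filterS filterT.
apply: filterS (filterI xN yN) => i [/= x0 y0].
by rewrite [LHS](_ : _ = x i - y i) // x0 y0 subrr.
Qed.
HB.instance Definition _ :=
  GRing.isZmodClosed.Build P null_mod null_mod_zmod_closed.

Let nullZ (a : R) : {in null_mod, forall x, a *: x \in null_mod}.
Proof.
move=> x /asboolP xN; apply/asboolP; apply: filterS xN => i /= x0.
by rewrite [LHS](_ : _ = a *: x i) // x0 scaler0.
Qed.
Let nulll y : {in null_mod, forall x, amul y x \in null_mod}.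
Proof.
move=> x /asboolP xN; apply/asboolP; apply: filterS xN => i /= x0.
by rewrite [LHS](_ : _ = amul (y i) (x i)) // x0 amulx0.
Qed.
Let nullr y : {in null_mod, forall x, amul x y \in null_mod}.
Proof.
move=> x /asboolP xN; apply/asboolP; apply: filterS xN => i /= x0.
by rewrite [LHS](_ : _ = amul (x i) (y i)) // x0 amul0x.
Qed.
HB.instance Definition _ := isAmulIdeal.Build R P null_mod nullZ nulll nullr.

Definition redprod : nalgType R := nalg_quot null_mod.

Definition redprod_proj (x : P) : redprod := nalg_proj null_mod x.

Lemma redprod_projP (x y : P) :
  redprod_proj x = redprod_proj y <-> filter F [set i | x i = y i].
Proof.
suff -> : [set i | x i = y i] = [set i | (x - y) i = 0].
  by split=> [/nalg_projP/asboolP|h]; last exact/nalg_projP/asboolP.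
apply/seteqP; split=> i /= => [e|/eqP].
  by rewrite [LHS](_ : _ = x i - y i) // e subrr.
by rewrite [X in X == _](_ : _ = x i - y i) // subr_eq0 => /eqP.
Qed.

End ReducedProduct.

Definition restr (R : comNzRingType) I (A : I -> nalgType R) (D : set I)
    (x : aprod A) : aprod (fun i : set_type D => A (set_val i)) :=
  fun i => x (set_val i).

Arguments restr {R I A} D x.

Definition factors_ultra (R : comNzRingType) I (A : I -> nalgType R)
    (B : nalgType R) (f : nalgHom (aprod A) B) (K : cardinal) : Prop :=
  exists (n : nat) (U : 'I_n -> filter_on I),
    (forall m, UltraFilter (filter (U m)) /\ succ_complete K (filter (U m))) /\
    exists g : nalgHom (aprod (fun m => redprod A (U m)))
                       (nalg_quot (total_ann B)),
      forall x, nalg_proj (total_ann B) (f x)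
                = g (fun m => redprod_proj (U m) x).

Definition factors_finite (R : comNzRingType) I (A : I -> nalgType R)
    (B : nalgType R) (f : nalgHom (aprod A) B) : Prop :=
  exists D : set I, finite_set D /\
    (exists g : nalgHom (aprod (fun i : set_type D => A (set_val i)))
                        (nalg_quot (total_ann B)),
       forall x, nalg_proj (total_ann B) (f x) = g (restr D x)) /\
    (exists f1 f0 : nalgHom (aprod A) B,
       [/\ forall x, f x = f1 x + f0 x,
           exists h : nalgHom (aprod (fun i : set_type D => A (set_val i))) B,
             forall x, f1 x = h (restr D x)
         & forall x, f0 x \in total_ann B]).

(* Main.v *)
(* Call [J] null if [f] kills every product supported on [J], equivalently maps
   the subproduct over [J] into [Z(B)].  Let [iota : I -> T].  If [rk B] is less
   than the size of a family of scalar vectors in [R^T] all of whose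
   combinations with a unit coefficient are units off a finite set, then for
   each [a] some such combination [u] satisfies [f (u a) = 0]; hence
   [f (a b) = f (u a) f (u^-1 b) = 0] for all [b] supported off finitely many
   fibers of [iota].  Consequently there is no infinite disjoint family of
   nonnull sets, and a union of [card T] null sets is null, so the algebra of
   sets modulo null sets is finite and its atoms give the ultrafilters.

   With [T] the residue field [k], a suitable family consists of the
   [card k] vectors [1 / (t - a)].  With [T = nat] one takes the [2^aleph_0]
   vectors [c_n ^ N(a, n)], where [N(a, n)] encodes [a] below [n] and [c_n] is
   chosen inductively so that all relevant minors are units.

   A nonprincipal [card(K)^+]-complete ultrafilter on [I] pushes forward to one
   witnessing that some cardinal [> card K] and [<= card I] is measurable. *)

Require Import Defs.
From HB Require Import structures.
From mathcomp Require Import all_boot all_order all_algebra.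
From mathcomp Require Import ring_quotient.
From mathcomp Require Import boolp classical_sets functions cardinality filter.

Set Implicit Arguments.
Unset Strict Implicit.
Unset Printing Implicit Defensive.

Import GRing.Theory.
Local Open Scope classical_set_scope.
Local Open Scope card_scope.
Local Open Scope ring_scope.
Local Open Scope quotient_scope.

(** * Cardinals and ultrafilters *)

Lemma card_le_inj T U (A : set T) (B : set U) :
  A #<= B <-> exists f : A -> B, injective f.
Proof.
split=> [/card_leP[f]|[f inj_f]].
  by exists f => x y; apply: inj; rewrite inE.
by apply/card_leP/injfunPex; exists f => // x y _ _; exact: inj_f.
Qed.

Lemma card_leT_inj T U :
  [set: T] #<= [set: U] <-> exists f : T -> U, injective f.
Proof.
split=> [/card_le_inj[f inj_f]|[f inj_f]].
  exists (fun x => val (f (SigSub (mem_set (I : setT x))))) => x y.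
  by move=> /val_inj/inj_f/(congr1 val).
apply/card_le_inj; exists (fun x => SigSub (mem_set (I : setT (f (val x))))).
by move=> x y /(congr1 val)/inj_f/val_inj.
Qed.

Lemma infinite_inj T (A : set T) :
  infinite_set A -> exists2 f : nat -> T, injective f & forall n, A (f n).
Proof.
move=> /infiniteP/card_le_inj[f inj_f].
exists (fun n => val (f (SigSub (mem_set (I : setT n))))) => [x y|n].
  by move=> /val_inj/inj_f/(congr1 val).
exact: set_valP.
Qed.

Lemma card_le_setType T (A : set T) : [set: A] #<= [set: T].
Proof. by apply/card_leT_inj; exists val; exact: val_inj. Qed.

(* A maximal set of tuples in the product of the [X t] on which all
   coordinates are injective must exhaust some [X t0]. *)
Lemma least_card (Ix : Type) (X : Ix -> Type) (t1 : Ix) :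
  exists t0, forall t, [set: X t0] #<= [set: X t].
Proof.
pose inj_coords (P : set (forall t, X t)) :=
  forall t p q, P p -> P q -> p t = q t -> p = q.
have [P [Pinj Pmax]] : exists P, inj_coords P /\
    forall Q, P `<` Q -> ~ inj_coords Q.
  apply: Zorn_bigcup => F FP Ftot t p q [Y FY Yp] [Z FZ Zq].
  by case: (Ftot Y Z FY FZ) => YZ;
    [apply: (FP Z FZ) => //; apply: YZ | apply: (FP Y FY) => //; apply: YZ].
have [[t0 t0surj]|nsurj] :=
    pselect (exists t0, forall x : X t0, exists2 p, P p & p t0 = x).
  exists t0 => t; apply/card_leT_inj.
  have [h hP] := choice (fun x => (fun '(ex_intro2 p Pp e) =>
    ex_intro (fun p => P p /\ p t0 = x) p (conj Pp e)) (t0surj x)).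
  exists (fun x => h x t) => x y /(Pinj t _ _ (hP x).1 (hP y).1) e.
  by rewrite -(hP x).2 -(hP y).2 e.
have miss t : exists x : X t, forall p, P p -> p t <> x.
  apply: contrapT => nx; apply: nsurj; exists t => x; apply: contrapT => np.
  by apply: nx; exists x => p Pp e; apply: np; exists p.
pose q t := sval (cid (miss t)).
have qP t p : P p -> p t <> q t by exact: (svalP (cid (miss t)) p).
case: (Pmax (P `|` [set q])).
  split=> [|/(_ q (or_intror erefl)) Pq]; first exact: subsetUl.
  exact: (qP t1 q Pq).
move=> t p p' [Pp|->] [Pp'|->] //; first exact: Pinj Pp Pp'.
  by move=> /qP.
by move=> /esym/qP.
Qed.

Lemma card_le_total (T U : Type) :
  [set: T] #<= [set: U] \/ [set: U] #<= [set: T].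
Proof.
have [[] h] := least_card (fun b : bool => if b then T else U) true.
  by left; exact: (h false).
by right; exact: (h true).
Qed.

Lemma ultraC_not I (U : set_system I) (A : set I) :
  UltraFilter U -> U (~` A) -> ~ U A.
Proof.
move=> UU UnA UA; apply: (@filter_not_empty _ U).
by rewrite -(setICr A); exact: filterI.
Qed.

Lemma ultra_notC I (U : set_system I) (A : set I) :
  UltraFilter U -> ~ U A -> U (~` A).
Proof. by move=> UU nUA; case: (in_ultra_setVsetC A UU). Qed.

Lemma ultraU I (U : set_system I) (A B : set I) :
  UltraFilter U -> U (A `|` B) -> U A \/ U B.
Proof.
move=> UU UAB; apply: contrapT => /not_orP[/ultra_notC nA /ultra_notC nB].
by apply: (@ultraC_not _ U (A `|` B)) UAB; rewrite setCU; exact: filterI.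
Qed.

Lemma ultra_intro I (U : set_system I) :
  Filter U -> ~ U set0 -> (forall A, U A \/ U (~` A)) -> UltraFilter U.
Proof.
move=> UF U0 UA; split=> [|G GG UG]; first by split.
apply/seteqP; split=> // A GA; case: (UA A) => // /UG GnA.
by case: (@filter_not_empty _ G); rewrite -(setICr A); exact: filterI.
Qed.

(* Let [X] be of least cardinality among the sets indexing a family of members
   of [U] whose intersection is not in [U].  Sending a point outside that
   intersection to the index of a member avoiding it pushes [U] forward to a
   nonprincipal [card X]-complete ultrafilter on [X]. *)
Lemma succ_complete_principal I (K : cardinal) (U : set_system I) :
  infinite_set [set: K] -> UltraFilter U -> succ_complete K U ->
  below_measurables I K -> principal U.
Proof.
move=> Kinf UU Ucompl Ismall; apply: contrapT => Unp.
pose bad (X : set I) := exists F : I -> set I,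
  (forall i, X i -> U (F i)) /\ ~ U (\bigcap_(i in X) F i).
(* A nonprincipal [U] contains the complement of every point, and these complements have empty
   intersection. *)
have badT : bad setT.
  exists (fun i => ~` [set i]); split.
    move=> i _; apply: ultra_notC => Ui; apply: Unp; exists i.
    apply/seteqP; split=> J /=; last first.
      by move=> Ji; apply: filterS Ui => _ ->.
    move=> UJ; apply: contrapT => nJi.
    by apply: (@filter_not_empty _ U); apply: filterS (filterI UJ Ui) => j [Jj /= e];
      apply: nJi; rewrite -e.
  rewrite (_ : bigcap _ _ = set0); first exact: filter_not_empty.
  by apply/seteqP; split=> // i /(_ i Logic.I)/=.
have [[X badX] Xmin] :=
  @least_card {X : set I | bad X} (fun X => set_type (sval X)) (exist _ _ badT).
rewrite /= in Xmin; have [F [FU FnU]] := badX.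
have nXK : ~~ ([set: X] #<= [set: K]).
  apply/negP => XK; apply: FnU.
  rewrite -(bigcap_image X F id); apply: Ucompl => [_ [i Xi <-]|]; first exact: FU.
  by apply: card_le_trans (card_image_le _ _) _; rewrite -(card_le_eql (card_setT X)).
have KX : [set: K] #< [set: X].
  by apply/andP; split=> //; have [//|] := card_le_total K X; rewrite (negPf nXK).
have XI : [set: X] #<= [set: I] := card_le_setType X.
suff Xmeas : measurable_cardinal X.
  by have /andP[_] := Ismall _ Xmeas KX; rewrite XI.
have Xinf : infinite_set [set: X].
  move=> Xfin; have /negP := nXK; apply.
  have [e inj_e _] := infinite_inj Kinf.
  have [n Xn] := Xfin; rewrite (card_le_eql Xn).
  apply: card_le_trans (card_leT _) _.
  by apply/card_leT_inj; exists e.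
split=> //.
have [x0 _] : [set: X] !=set0 by exact: infinite_setN0.
have hex i : exists x : X, (\bigcap_(i in X) F i) i \/ ~ F (val x) i.
  have [?|nFi] := pselect ((\bigcap_(i in X) F i) i); first by exists x0; left.
  have [j] : exists j, ~ (X j -> F j i) by exact/existsNP.
  by move=> /not_implyP[Xj nF]; exists (SigSub (mem_set Xj)); right.
have [h hP] := choice hex.
(* The fiber over [x] lies in the union of the bad intersection and the complement of [F x], neither
   of which is in [U]. *)
have fiber x : ~ U (h @^-1` [set x]).
  move=> Ux; have /ultraU : U (\bigcap_(i in X) F i `|` ~` F (val x)).
    by apply: filterS Ux => i <-; exact: hP.
  by case=> // /ultraC_not; apply; apply: FU; exact: set_valP.
exists [set J | U (h @^-1` J)]; split.
- apply: ultra_intro.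
  + by rewrite /= preimage_set0; exact: filter_not_empty.
  + by move=> J /=; exact: in_ultra_setVsetC.
- move=> [x ex]; apply: (fiber x).
  by have : [set J : set X | J x] [set x] by []; rewrite -ex.
(* A family [S] violating completeness gives a bad index set no larger than [S], against the
   minimality of [X]. Since [bad] speaks of subsets of [I], that index set is the image of [S] in
   [I]. *)
- move=> S SU /andP[SX nXS]; apply: contrapT => nS; move/negP: nXS; apply.
  have /card_le_inj[g inj_g] := SX.
  pose g' (J : S) : I := val (val (g J)).
  have inj_g' : injective g' by move=> J J' /val_inj/val_inj/inj_g.
  have badS : bad (range g').
    exists (fun i => \bigcap_(J in [set J : S | g' J = i]) (h @^-1` (val J))).
    split=> [_ [J _ <-]|].
      rewrite (_ : bigcap _ _ = h @^-1` (val J)).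
        by apply: SU; exact: set_valP.
      apply/seteqP; split=> [i /(_ J erefl)//|i hi J' /inj_g' ->//].
    move=> UI; apply: nS; rewrite /=; apply: (filterS _ UI) => i Ii J SJ.
    have /= := Ii _ (imageP g' (Logic.I : setT (SigSub (mem_set SJ)))).
    by move=> /(_ (SigSub (mem_set SJ)) erefl).
  apply: card_le_trans (Xmin (exist _ _ badS)) _ => /=.
  rewrite (card_le_eql (card_setT _)) -(card_le_eqr (card_setT S)).
  exact: card_image_le.
Qed.

(** * Rank *)

Section RankExchange.
Variables (R : idomainType) (V : lmodType R).
Implicit Types (W X Y : set V) (u v w x y : V).

Definition lin_span W v := exists s : seq (R * V),
  (forall p, p \in s -> W p.2) /\ v = \sum_(p <- s) p.1 *: p.2.

(** Dependence after clearing denominators: the preimage in [V] of the span of [W] over the fraction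
    field. *)
Definition lin_closure W v := exists2 r : R, r != 0 & lin_span W (r *: v).

Lemma lin_spanP W (a : R) u v :
  lin_span W u -> lin_span W v -> lin_span W (a *: u + v).
Proof.
move=> [s [sW ->]] [t [tW ->]].
exists ([seq (a * p.1, p.2) | p <- s] ++ t); split=> [p|].
  by rewrite mem_cat => /orP[/mapP[q qs ->]|/tW]//; exact: (sW q).
rewrite big_cat big_map scaler_sumr; congr (_ + _).
by apply: eq_bigr => p _; rewrite scalerA.
Qed.

Lemma lin_span0 W : lin_span W 0.
Proof. by exists [::]; rewrite big_nil. Qed.

Lemma lin_spanZ W (a : R) u : lin_span W u -> lin_span W (a *: u).
Proof. by move=> Wu; rewrite -[_ *: _]addr0; apply: lin_spanP (lin_span0 W). Qed.

Lemma lin_span_uniq W (s : seq V) (c : V -> R) :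
  (forall v, v \in s -> W v) -> lin_span W (\sum_(v <- s) c v *: v).
Proof.
move=> sW; exists [seq (c v, v) | v <- s]; split=> [p /mapP[v vs ->]|].
  exact: sW.
by rewrite big_map.
Qed.

Lemma lin_closure_sub W v : W v -> lin_closure W v.
Proof.
move=> Wv; exists 1; first exact: oner_neq0.
exists [:: (1, v)]; split=> [p|]; last by rewrite big_seq1.
by rewrite inE => /eqP ->.
Qed.

Lemma lin_closureP W (a : R) u v :
  lin_closure W u -> lin_closure W v -> lin_closure W (a *: u + v).
Proof.
move=> [r r0 ru] [q q0 qv]; exists (r * q); first by rewrite mulf_neq0.
have -> : (r * q) *: (a *: u + v) = (q * a) *: (r *: u) + r *: (q *: v).
  rewrite scalerDr !scalerA; congr (_ *: _ + _).
  by rewrite -mulrA mulrC.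
by apply: lin_spanP => //; exact: lin_spanZ.
Qed.

Lemma lin_closure_trans X W v :
  X `<=` lin_closure W -> lin_closure X v -> lin_closure W v.
Proof.
move=> XW [r r0 [s [sX e]]].
have [q q0 h] : lin_closure W (r *: v).
  rewrite {}e; elim: s sX => [|p s IHs] sX.
    by rewrite big_nil; exists 1; [exact: oner_neq0 | rewrite scaler0; exact: lin_span0].
  rewrite big_cons; apply: lin_closureP; last first.
    by apply: IHs => p' ps; apply: sX; rewrite inE ps orbT.
  by apply/XW/sX; rewrite mem_head.
by exists (q * r); rewrite ?mulf_neq0 // -scalerA.
Qed.

Lemma lin_indep_notin_closure W y :
  lin_indep (y |` W) -> ~ W y -> ~ lin_closure W y.
Proof.
move=> ind nWy [r r0 [s [sW e]]].
(* A spanning list may repeat vectors, whereas [lin_indep] tests duplicate-free lists, so the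
   coefficients of equal vectors are collected. *)
pose c w := \sum_(p <- s | p.2 == w) p.1.
pose t := undup [seq p.2 | p <- s].
have tW w : w \in t -> W w by rewrite mem_undup => /mapP[p ps ->]; exact: sW.
have sumE : \sum_(w <- t) c w *: w = r *: y.
  rewrite e; under eq_bigr do rewrite scaler_suml.
  rewrite (exchange_big_dep predT) //= [RHS]big_seq big_seq.
  apply: eq_bigr => p ps; under eq_bigl do rewrite eq_sym.
  rewrite -big_filter filter_pred1_uniq ?undup_uniq ?mem_undup ?big_seq1 //.
  exact: map_f.
have yt : y \notin t by apply/negP => /tW.
have := ind (y :: t) (fun w => if w == y then - r else c w).
move=> /(_ _ _ _ y (mem_head _ _)); rewrite eqxx => h.
move: r0; rewrite -oppr_eq0 h ?eqxx //=.
- by rewrite yt undup_uniq.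
- by move=> w; rewrite inE => /orP[/eqP ->|/tW]; [left|right].
- rewrite big_cons eqxx -[RHS](addNr (r *: y)) scaleNr; congr (_ + _).
  rewrite -sumE big_seq [RHS]big_seq; apply: eq_bigr => w wt.
  by case: eqP => // wy; rewrite -wy wt in yt.
Qed.

Lemma lin_indepU1 W x : lin_indep W -> ~ lin_closure W x -> lin_indep (x |` W).
Proof.
move=> ind nx s c us sW sum0.
(* A nonzero coefficient of [x] would be a denominator placing [x] in the closure of [W]. *)
have cx0 : x \in s -> c x = 0.
  move=> xs; apply: contrapT => /eqP cx0; apply: nx.
  exists (- c x); first by rewrite oppr_eq0.
  move: sum0; rewrite (bigD1_seq x) //= => /eqP.
  rewrite addrC addr_eq0 -scaleNr => /eqP <-; rewrite -big_filter.
  apply: lin_span_uniq => v; rewrite mem_filter => /andP[/eqP vx /sW[]//].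
move=> v vs; have [vx|vx] := eqVneq v x; first by rewrite vx cx0 // -vx.
apply: (ind [seq w <- s | w != x]); last by rewrite mem_filter vx.
- exact: filter_uniq.
- by move=> w; rewrite mem_filter => /andP[/eqP wx /sW[]].
- rewrite big_filter -[RHS]sum0.
  have [xs|xs] := boolP (x \in s).
    by rewrite [RHS](bigD1_seq x) //= cx0 // scale0r add0r.
  rewrite big_seq_cond [RHS]big_seq; apply: eq_bigl => w.
  by have [ws|//] := boolP (w \in s); apply/eqP => wx; rewrite -wx ws in xs.
Qed.

Lemma max_lin_indep_closure X v : max_lin_indep X -> lin_closure X v.
Proof.
move=> [ind Xmax]; apply: contrapT => nXv.
apply: (Xmax (v |` X)); last exact: lin_indepU1.
split; first exact: subsetUr.
by move=> /(_ v (or_introl erefl)) Xv; apply: nXv; exact: lin_closure_sub.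
Qed.

Lemma lin_indepS W X : W `<=` X -> lin_indep X -> lin_indep W.
Proof. by move=> WX ind s c us sW; apply: ind => // v /sW; exact: WX. Qed.

(* Zorn's lemma yields a maximal partial injection [G] from [Y] to [X] such
   that replacing its domain by its image in [Y] preserves independence. *)
Lemma lin_indep_card_le X Y : max_lin_indep X -> lin_indep Y -> Y #<= X.
Proof.
move=> Xmax indY.
pose rest (G : set (V * V)) := Y `\` [set p.1 | p in G].
pose im (G : set (V * V)) := [set p.2 | p in G].
pose exchange (G : set (V * V)) :=
  [/\ forall p, G p -> Y p.1 /\ X p.2,
      forall p q, G p -> G q -> p.1 = q.1 \/ p.2 = q.2 -> p = q,
      forall v, im G v -> ~ rest G v
    & lin_indep (rest G `|` im G)].
have [G [[GYX Ginj Gdisj Gind] Gmax]] : exists G, exchange G /\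
    forall H, G `<` H -> ~ exchange H.
  apply: Zorn_bigcup => F FP Ftot.
  have in2 p q : (\bigcup_(G in F) G) p -> (\bigcup_(G in F) G) q ->
      exists2 G, F G & G p /\ G q.
    move=> [G FG Gp] [H FH Hq].
    by case: (Ftot G H FG FH) => GH; [exists H | exists G] => //; split=> //; exact: GH.
  split.
  - by move=> p [G FG Gp]; have [+ _ _ _] := FP G FG; exact.
  - move=> p q Fp Fq; have [G FG [Gp Gq]] := in2 p q Fp Fq.
    by have [_ + _ _] := FP G FG; exact.
  - move=> v [p [G FG Gp] pv] [Yv nv]; have [_ _ + _] := FP G FG.
    move=> /(_ v); apply; first by exists p.
    by split=> // -[q Gq qv]; apply: nv; exists q => //; exists G.
  - move=> s c us sW sum0 v vs.
    have [[G0 FG0]|F0] := pselect (exists G, F G); last first.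
      apply: (indY s c us) => // w /sW[[]//|[p [G FG _] _]].
      by case: F0; exists G.
    (* The finitely many vectors of [s] involve only finitely many pairs, all in one member [G] of
       the chain, and [rest] shrinks as its argument grows. *)
    suff [G FG sG] : exists2 G, F G &
        forall w, w \in s -> rest (\bigcup_(G in F) G) w \/ im G w.
      have [_ _ _ ind] := FP G FG; apply: (ind s c us) => // w /sG[|]; last by right.
      move=> [Yw nw]; left; split=> // -[p Gp pw]; apply: nw.
      by exists p => //; exists G.
    elim: s {us sum0 v vs} sW => [|w s IHs] sW; first by exists G0.
    have [|G FG sG] := IHs; first by move=> u us; apply: sW; rewrite inE us orbT.
    have [wr|[p [H FH Hp] pw]] := sW w (mem_head _ _).
      by exists G => // u; rewrite inE => /orP[/eqP ->|/sG//]; left.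
    case: (Ftot G H FG FH) => GH.
      exists H => // u; rewrite inE => /orP[/eqP ->|/sG[]]; [by right; exists p|by left|].
      by move=> [q Gq qu]; right; exists q => //; exact: GH.
    exists G => // u; rewrite inE => /orP[/eqP ->|/sG//]; right; exists p => //.
    exact: GH.
(* For [y] outside the domain, [y] is not in the closure of the other vectors [W], hence neither is
   some [x] in [X]; adding [(y, x)] to [G] contradicts maximality. *)
have domG y : Y y -> exists x, G (y, x).
  move=> Yy; apply: contrapT => ny.
  have ry : rest G y.
    by split=> // -[[y' x] Gyx /= yy']; apply: ny; exists x; rewrite -yy'.
  pose W := (rest G `\ y) `|` im G.
  have Wy : ~ W y by move=> [[_ nyy]|iy]; [exact: nyy | exact: Gdisj iy ry].
  have indW : lin_indep W.
    by apply: lin_indepS Gind => v [[rv _]|]; [left|right].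
  have nWy : ~ lin_closure W y.
    apply: lin_indep_notin_closure => //; apply: lin_indepS Gind => v.
    by move=> [->|[[rv _]|]]; [left|left|right].
  have [x Xx nWx] : exists2 x, X x & ~ lin_closure W x.
    apply: contrapT => nx; apply: nWy; apply: (lin_closure_trans (X := X)).
      by move=> x Xx; apply: contrapT => nWx; apply: nx; exists x.
    exact: max_lin_indep_closure.
  have restE v : rest ((y, x) |` G) v -> (rest G `\ y) v.
    move=> [Yv nv]; split; last by move=> vy; apply: nv; exists (y, x); [left|].
    by split=> // -[q Gq qv]; apply: nv; exists q => //; right.
  have imE v : im ((y, x) |` G) v -> v = x \/ im G v.
    by move=> [q [->|Gq] <-]; [left|right; exists q].
  have nimx : ~ im G x by move=> Gx; apply: nWx; apply: lin_closure_sub; right.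
  apply: (Gmax ((y, x) |` G)).
    split; first exact: subsetUr.
    by move=> /(_ (y, x) (or_introl erefl)) Gyx; apply: ny; exists x.
  split.
  - by move=> p [->//|]; exact: GYX.
  - have new q : G q -> y = q.1 \/ x = q.2 -> False.
      move=> Gq [yq|xq]; last by apply: nimx; exists q.
      by apply: ny; exists q.2; rewrite yq -surjective_pairing.
    move=> p q [->|Gp] [->|Gq] //; last exact: Ginj.
      by move=> /(new q Gq).
    by move=> e; case: (new p Gp); case: e => ->; [left|right].
  - move=> v /imE[->|iv] /restE [rv vy]; last exact: Gdisj iv rv.
    by apply: nWx; apply: lin_closure_sub; left.
  - apply: lin_indepS (lin_indepU1 indW nWx) => v [/restE rv|/imE[->|iv]].
    + by right; left.
    + by left.
    + by right; right.
have [phi phiP] := choice (fun y : Y => domG (val y) (set_valP y)).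
apply/card_le_inj.
exists (fun y : set_type Y => SigSub (mem_set (GYX _ (phiP y)).2)).
move=> y y' /(congr1 val)/= e.
by apply: val_inj; have [] := Ginj _ _ (phiP y) (phiP y') (or_intror e).
Qed.

End RankExchange.

(** * Relations forced by a rank bound *)

Lemma family_dependent (R : idomainType) (V : lmodType R) (L : eqType)
    (b : L -> V) :
  ~~ ([set: L] #<= rank_set V) ->
  exists (s : seq L) (d : L -> R),
    [/\ uniq s, \sum_(a <- s) d a *: b a = 0
      & exists2 a, a \in s & d a != 0].
Proof.
move=> nL; have Xmax : max_lin_indep (rank_set V) by exact: svalP (cid _).
have [a0 _] : [set: L] !=set0.
  by apply/set0P; apply: contraNneq nL => ->.
(* Two indices carrying the same vector already give a relation, with coefficients 1 and -1. *)
have [binj|] := pselect (injective b); last first.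
  move=> /existsNP[a /existsNP[a' /not_implyP[baa' /eqP naa']]].
  exists [:: a; a'], (fun c => if c == a then 1 else -1); split.
  - by rewrite /= inE naa'.
  - rewrite !big_cons big_nil eqxx eq_sym (negPf naa') baa' scale1r scaleN1r.
    by rewrite addr0 subrr.
  - by exists a; rewrite ?mem_head // eqxx oner_neq0.
have nind : ~ lin_indep (range b).
  move=> /(lin_indep_card_le Xmax) bX; move/negP: nL; apply.
  by apply: card_le_trans bX; rewrite -(card_le_eql (inj_card_eq (in2W binj))).
move: nind => /existsNP[s /existsNP[c /not_implyP[us]]].
move=> /not_implyP[sb /not_implyP[sum0 /existsNP[v /not_implyP[vs /eqP cv]]]].
have hex v' : exists a, v' \in s -> b a = v'.
  have [/sb[a _ <-]|_] := boolP (v' \in s); by [exists a | exists a0].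
have [h hP] := choice hex.
exists (map h s), (c \o b); split.
- rewrite map_inj_in_uniq // => x y xs ys /(congr1 b).
  by rewrite !hP.
- rewrite big_map -[RHS]sum0 big_seq [RHS]big_seq.
  by apply: eq_bigr => w ws; rewrite /= hP.
- by exists (h v); [exact: map_f | rewrite /= hP].
Qed.

(** Divisibility is total, so scanning the list and keeping the divisor at each stage finds a
    coefficient of least valuation. *)
Lemma max_valuation (R : valRingType) (L : eqType) (s : seq L) (d : L -> R) :
  (exists2 a, a \in s & d a != 0) ->
  exists2 a, a \in s & forall a', a' \in s -> exists z, d a' = z * d a.
Proof.
move=> [a0 + _]; case: s => // a1 s _.
elim: s a1 => [|a s IHs] a1.
  exists a1; rewrite ?mem_head // => a'; rewrite inE => /eqP ->.
  by exists 1; rewrite mul1r.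
have [b bs bP] := IHs a.
have [[z e]|[z e]] := dvdr_total (d a1) (d b).
  exists a1; rewrite ?mem_head // => a'; rewrite inE => /orP[/eqP ->|/bP[y ->]].
    by exists 1; rewrite mul1r.
  by exists (y * z); rewrite e mulrA.
exists b; first by rewrite inE bs orbT.
by move=> a'; rewrite inE => /orP[/eqP ->|/bP//]; exists z.
Qed.

(** Dividing a relation by a coefficient that divides all the others turns that coefficient into 1;
    torsion-freeness keeps the divided sum zero. *)
Lemma family_unit_dependent (R : valRingType) (V : lmodType R) (L : eqType)
    (b : L -> V) :
  torsion_free V -> ~~ ([set: L] #<= rank_set V) ->
  exists (s : seq L) (d : L -> R),
    [/\ uniq s, \sum_(a <- s) d a *: b a = 0
      & exists2 a, a \in s & d a \is a GRing.unit].
Proof.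
move=> tf /(family_dependent b)[s [d [us sum0 dn0]]].
have [a as_ aP] := max_valuation dn0.
have da0 : d a <> 0.
  by case: dn0 => a' /aP[z ->] /eqP + da; rewrite da mulr0.
have qex a' : exists z, a' \in s -> d a' = z * d a.
  by have [/aP[z ->]|_] := boolP (a' \in s); [exists z | exists 0].
have [q qP] := choice qex.
exists s, q; split=> //; last first.
  exists a => //; have /eqP : (q a - 1) * d a = 0 by rewrite mulrBl mul1r -qP ?subrr.
  by rewrite mulf_eq0 subr_eq0 => /orP[/eqP ->|/eqP//]; exact: unitr1.
have /tf[//|//] : d a *: (\sum_(a' <- s) q a' *: b a') = 0.
rewrite scaler_sumr -[RHS]sum0 big_seq [RHS]big_seq.
by apply: eq_bigr => a' a's; rewrite scalerA mulrC -qP.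
Qed.

(** * Generic families of scalars *)

Section LocalRing.
Variable R : valRingType.
Local Notation k := (residue_field R).
Local Notation m := (@max_ideal R).

Lemma max_idealE (x : R) : (x \in m) = (x \isn't a GRing.unit).
Proof. by rewrite inE. Qed.

Lemma max_idealM (a x : R) : x \in m -> a * x \in m.
Proof. exact: idealMr. Qed.

Definition rep (c : k) : R := repr c.

Lemma rep_unit (c c' : k) : c != c' -> rep c - rep c' \is a GRing.unit.
Proof.
apply: contraNT => h; apply/eqP; rewrite -[c]reprK -[c']reprK.
by apply/eqP; rewrite piE Quotient.equivE.
Qed.

(** The inverse matrix preserves vectors with entries in the ideal. Contrapositively, a vector with
    a unit entry has an image with a unit entry. *)
Lemma mulmx_max_ideal n (M : 'M[R]_n) (d : 'cV[R]_n) :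
  \det M \is a GRing.unit -> (forall i, (M *m d) i 0 \in m) ->
  forall i, d i 0 \in m.
Proof.
rewrite -unitmxE => uM h i; rewrite -(mulKmx uM d) mxE.
by apply: rpred_sum => j _; apply: max_idealM.
Qed.

(* The Vandermonde determinant at [n] points with distinct residues is a unit,
   so a polynomial of size [n] taking values in the maximal ideal at them has
   all its coefficients in the maximal ideal. *)
Lemma finite_nonunit_horner (p : {poly R}) (i0 : nat) :
  p`_i0 \is a GRing.unit ->
  finite_set [set c : k | p.[rep c] \in m].
Proof.
move=> up; apply: contrapT => /infinite_inj[e inj_e em].
pose a : 'rV[R]_(size p) := \row_i rep (e i).
pose d : 'cV[R]_(size p) := \col_i p`_i.
have /mulmx_max_ideal : \det (Vandermonde (size p) a)^T \is a GRing.unit.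
  rewrite det_tr det_Vandermonde; apply: rpred_prod => i _.
  apply: rpred_prod => j ij; rewrite !mxE; apply: rep_unit.
  by apply: contraTneq ij => /inj_e ->; rewrite ltnn.
move=> /(_ d) dm.
have i0p : (i0 < size p)%N.
  by rewrite ltnNge; apply/negP => /(nth_default 0) p0; rewrite p0 unitr0 in up.
have /dm/(_ (Ordinal i0p)) : forall i, ((Vandermonde (size p) a)^T *m d) i 0 \in m.
  move=> i; rewrite mxE; have := em i; rewrite /= horner_coef.
  by congr (_ \in m); apply: eq_bigr => j _; rewrite !mxE mulrC.
by rewrite mxE max_idealE up.
Qed.

Lemma horner_max_ideal (p : {poly R}) (c : R) :
  (forall i, p`_i \in m) -> p.[c] \in m.
Proof.
move=> h; rewrite horner_coef; apply: rpred_sum => i _.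
by rewrite mulrC; exact: max_idealM.
Qed.

(** Over the residue field: every nontrivial linear combination of the reduced vectors vanishes at
    only finitely many coordinates. *)
Definition generic_family (T : Type) (L : eqType) (x : L -> T -> R) :=
  forall (s : seq L) (d : L -> R), uniq s ->
    (exists2 a, a \in s & d a \is a GRing.unit) ->
    finite_set [set t | \sum_(a <- s) d a * x a t \in m].

(* Clearing denominators turns a combination of the [1 / (X - rep a)] into a
   polynomial whose value at [rep a] is a unit multiple of the coefficient. *)
Lemma generic_fractions :
  generic_family (fun a t : k => (rep t - rep a)^-1).
Proof.
move=> s d us [a as_ uda].
pose P := \sum_(b <- s) d b *: \prod_(c <- s | c != b) ('X - (rep c)%:P).
have Pa : P.[rep a] \is a GRing.unit.
  rewrite /P horner_sum (bigD1_seq a) //= [X in _ + X]big1_seq => [|b /andP[ba bs]].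
    rewrite addr0 hornerZ unitrM uda horner_prod; apply: rpred_prod => c ca.
    by rewrite hornerXsubC; apply: rep_unit; rewrite eq_sym.
  rewrite hornerZ horner_prod (big_rem a) //= eq_sym ba hornerXsubC subrr.
  by rewrite mul0r mulr0.
(* If all coefficients lay in the maximal ideal, so would the value at [rep a]. *)
have [i Pi] : exists i, P`_i \is a GRing.unit.
  apply: contrapT => nP; suff : P.[rep a] \in m by rewrite max_idealE Pa.
  apply: horner_max_ideal => i; rewrite max_idealE.
  by apply/negP => Pi; apply: nP; exists i.
(* At the points of [s] some difference [rep t - rep c] is zero and cannot be cancelled, so these
   points are set aside. *)
have Pfin : finite_set ([set` s] `|` [set c | P.[rep c] \in m]).
  by rewrite finite_setU; split; [exact: finite_seq | exact: finite_nonunit_horner Pi].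
apply: sub_finite_set Pfin.
move=> t tm; have [ts|ts] := boolP (t \in s); [by left|right] => /=.
rewrite (_ : P.[_] = (\prod_(c <- s) (rep t - rep c)) *
  \sum_(b <- s) d b * (rep t - rep b)^-1); first exact: max_idealM.
rewrite horner_sum mulr_sumr; apply: eq_big_seq => b bs.
rewrite hornerZ horner_prod mulrCA; congr (_ * _).
rewrite [in RHS](bigD1_seq b) //= mulrAC divrr ?mul1r.
  by apply: eq_bigr => c _; rewrite hornerXsubC.
by apply: rep_unit; apply: contraNneq ts => ->.
Qed.

(** The number whose binary digits are the characteristic function of [a] below [n]. Reduction
    modulo [2 ^ l] therefore recovers the code at an earlier stage [l]. *)
Fixpoint subset_code (a : set nat) (n : nat) : nat :=
  if n is l.+1 then subset_code a l + `[< a l >] * 2 ^ l else 0.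

Lemma subset_code_lt a n : (subset_code a n < 2 ^ n)%N.
Proof.
elim: n => //= n IHn; rewrite expnS mul2n -addnn.
by case: `[< _ >]; rewrite ?mul1n ?mul0n ?ltn_add2r // addn0 ltn_addr.
Qed.

Lemma subset_code_mod a l n :
  (l <= n)%N -> (subset_code a n %% 2 ^ l)%N = subset_code a l.
Proof.
elim: n => [|n IHn]; first by rewrite leqn0 => /eqP ->; rewrite modn1.
rewrite leq_eqVlt => /orP[/eqP ->|ln]; first by rewrite modn_small ?subset_code_lt.
rewrite /= -modnDmr (_ : (_ * 2 ^ n) %% 2 ^ l = 0)%N ?addn0 ?IHn //.
by apply/eqP; apply: dvdn_mull; apply: dvdn_exp2l.
Qed.

(** Reduction modulo powers of 2 carries an equality at [l] down to stages [n.+1] and [n], whose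
    codes differ by the digit [n]. *)
Lemma subset_code_neq a b n l :
  a n <> b n -> (n < l)%N -> subset_code a l != subset_code b l.
Proof.
move=> ab nl; apply/eqP => e.
have : subset_code a n.+1 = subset_code b n.+1.
  by rewrite -(subset_code_mod a nl) e subset_code_mod.
have : subset_code a n = subset_code b n.
  by rewrite -(subset_code_mod a (ltnW nl)) e subset_code_mod // ltnW.
rewrite /= => -> /addnI/eqP; rewrite eqn_pmul2r ?expn_gt0 // => /eqP abn.
by apply: ab; apply/propext; move: abn; do 2![case: asboolP => ?] => //; split.
Qed.

(** Columns are given by numbers instead of subsets: the row at stage [rho i] sees [gam j] only
    modulo [2 ^ rho i], which for a later code is the code at that stage. *)
Definition code_mx (c : nat -> R) n (rho gam : 'I_n -> nat) : 'M[R]_n :=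
  \matrix_(i, j) c (rho i) ^+ (gam j %% 2 ^ rho i)%N.

(** The Laplace expansion of a [code_mx] determinant along an extra last row at stage [l], with the
    value [c l] replaced by the indeterminate. *)
Definition code_poly (c : nat -> R) n l (rho : 'I_n -> nat)
    (gam : 'I_n.+1 -> nat) : {poly R} :=
  \sum_(j < n.+1) ((-1) ^+ (n + j) * \det (code_mx c rho (gam \o lift j))) *:
    'X^(gam j %% 2 ^ l)%N.

Lemma det_code_mx c n (rho gam : 'I_n.+1 -> nat) :
  \det (code_mx c rho gam) =
  (code_poly c (rho ord_max) (rho \o lift ord_max) gam).[c (rho ord_max)].
Proof.
rewrite (expand_det_row _ ord_max) /code_poly horner_sum.
apply: eq_bigr => j _; rewrite mxE hornerZ hornerXn mulrC; congr (_ * _ * _).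
by congr (\det _); apply/matrixP => i j'; rewrite !mxE.
Qed.

(** Each [2 ^ rho i] divides [2 ^ l], so residues modulo [2 ^ l] determine all exponents. This
    permits bounded [gam] and a finite prefix of [c]. *)
Lemma code_poly_ext (c c' : nat -> R) n l (rho rho' : 'I_n -> nat)
    (gam gam' : 'I_n.+1 -> nat) :
  (forall i, c (rho i) = c' (rho' i)) -> (forall i, rho i = rho' i) ->
  (forall i, (rho i < l)%N) -> (forall j, gam j = gam' j %[mod 2 ^ l])%N ->
  code_poly c l rho gam = code_poly c' l rho' gam'.
Proof.
move=> cc' rr' rl gg'; apply: eq_bigr => j _; rewrite gg'; congr (_ * \det _ *: _).
apply/matrixP => i j'; rewrite !mxE cc' -rr' /=; congr (_ ^+ _).
have dv : ((2 ^ rho i)%N %| (2 ^ l)%N)%N by apply: dvdn_exp2l; exact: ltnW.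
by rewrite -(modn_dvdm _ dv) gg' modn_dvdm.
Qed.

(* Each [c l] avoids the residual roots of the finitely many polynomials that
   arise by expanding, along its last row, a determinant whose earlier rows
   involve only [c 0 .. c l.-1]. *)
Lemma generic_sequence :
  infinite_set [set: k] ->
  exists c : nat -> R, forall l n (rho : 'I_n -> nat) (gam : 'I_n.+1 -> nat),
    (n <= l)%N -> (forall i, (rho i < l)%N) ->
    (exists i, (code_poly c l rho gam)`_i \is a GRing.unit) ->
    (code_poly c l rho gam).[c l] \is a GRing.unit.
Proof.
move=> kinf.
have step (s : seq R) : exists x : R, forall n (rho : 'I_n -> nat) gam,
    (n <= size s)%N -> (forall i, (rho i < size s)%N) ->
    (exists i, (code_poly (nth 0 s) (size s) rho gam)`_i \is a GRing.unit) ->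
    (code_poly (nth 0 s) (size s) rho gam).[x] \is a GRing.unit.
  set l := size s.
  pose bad (p : {poly R}) := [set c : k |
    (exists i, p`_i \is a GRing.unit) /\ p.[rep c] \in m].
  have bad_fin p : finite_set (bad p).
    have [[i pi]|np] := pselect (exists i, p`_i \is a GRing.unit).
      by apply: sub_finite_set (finite_nonunit_horner pi) => c [].
    by apply: sub_finite_set (finite_set0 _) => c [].
  (* Up to residues of [gam] modulo [2 ^ l], the polynomials of stage [l] form a finite family, so
     their bad residues cannot exhaust the infinite [k]. *)
  pose idx := {n : 'I_l.+1 & ({ffun 'I_n -> 'I_l} * {ffun 'I_n.+1 -> 'I_(2 ^ l)%N})%type}.
  pose pol (w : idx) := code_poly (nth 0 s) l
    (fun i => (tagged w).1 i : nat) (fun j => (tagged w).2 j : nat).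
  have [x nx] : exists x, ~ (\bigcup_(w in [set: idx]) bad (pol w)) x.
    apply: contrapT => /forallNP nbad; apply: kinf.
    apply: sub_finite_set (bigcup_finite (finite_finset (X := [set: idx]))
      (fun w _ => bad_fin (pol w))).
    by move=> x _; apply: contrapT; exact: nbad.
  exists (rep x) => n rho gam nl rhol pu.
  pose w : idx := Tagged (fun n : 'I_l.+1 =>
      ({ffun 'I_n -> 'I_l} * {ffun 'I_n.+1 -> 'I_(2 ^ l)%N})%type)
    (i := Ordinal (nl : (n < l.+1)%N))
    ([ffun i => Ordinal (rhol i)],
     [ffun j => Ordinal (ltn_pmod (gam j) (expn_gt0 2 l))]).
  have polE : code_poly (nth 0 s) l rho gam = pol w.
    by apply: code_poly_ext => // i; rewrite !ffunE //= modn_mod.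
  apply: contrapT => /negP px; apply: nx; exists w => //; split; rewrite -polE //.
have [next nextP] := choice step.
(* Each value is chosen from the list of all previous ones; [pre n] lists the first [n] values. *)
pose fix pre n := if n is l.+1 then rcons (pre l) (next (pre l)) else [::].
pose c n := next (pre n).
have size_pre n : size (pre n) = n by elim: n => //= n IHn; rewrite size_rcons IHn.
have nth_pre n i : (i < n)%N -> nth 0 (pre n) i = c i.
  elim: n => //= n IHn; rewrite ltnS leq_eqVlt nth_rcons size_pre.
  by move=> /orP[/eqP ->|lin]; rewrite ?ltnn ?eqxx // lin IHn.
exists c => l n rho gam nl rhol.
rewrite (_ : code_poly c l rho gam = code_poly (nth 0 (pre l)) (size (pre l)) rho gam).
  by move=> pu; apply: nextP => //; rewrite size_pre.
by rewrite size_pre; apply: code_poly_ext => // i; rewrite nth_pre.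
Qed.

Lemma leq_increasing n (rho : 'I_n -> nat) (i : 'I_n) :
  {homo rho : i j / (i < j)%N} -> (i <= rho i)%N.
Proof.
move=> rho_incr; case: i => i; elim: i => //= i IHi lin.
apply: leq_ltn_trans (IHi (ltnW lin)) _.
exact: (rho_incr (Ordinal (ltnW lin)) (Ordinal lin) (ltnSn i)).
Qed.

(* Distinct subsets of [nat] have distinct codes at all large [l], which makes
   the minors of the matrix with entries [c l ^+ subset_code a l] units. *)
Lemma generic_codes :
  infinite_set [set: k] -> exists x : set nat -> nat -> R, generic_family x.
Proof.
move=> /generic_sequence[c cP].
have unit_mx n (rho gam : 'I_n -> nat) : {homo rho : i j / (i < j)%N} ->
    (forall i, injective (fun j => gam j %% 2 ^ rho i)%N) ->
    \det (code_mx c rho gam) \is a GRing.unit.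
  elim: n rho gam => [|n IHn] rho gam rho_incr gam_inj.
    by rewrite det_mx00 unitr1.
  have rho_max i : (rho (lift ord_max i) < rho ord_max)%N.
    by apply: rho_incr; rewrite lift_max /=.
  rewrite det_code_mx; apply: cP => //; first exact: (leq_increasing ord_max).
  (* The exponents in the last row are distinct, so this coefficient is up to sign a single minor, a
     unit by induction. *)
  exists (gam ord0 %% 2 ^ rho ord_max)%N; rewrite coef_sum (bigD1 ord0) //= big1.
    rewrite addr0 coefZ coefXn eqxx mulr1 unitrM unitrX ?unitrN1 //=.
    apply: IHn => [i j ij|i j j' /gam_inj/lift_inj//].
    by apply: rho_incr; rewrite !lift_max.
  move=> j j0; rewrite coefZ coefXn; case: eqP => [/gam_inj e|]; last by rewrite mulr0.
  by rewrite e eqxx in j0.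
exists (fun a n => c n ^+ subset_code a n) => s d us [a as_ uda].
set Z := [set t | _]; apply: contrapT => Zinf.
have Zub l : exists n, Z n /\ (l <= n)%N.
  apply: contrapT => /forallNP nZ; apply: Zinf.
  apply: sub_finite_set (finite_II l) => n Zn.
  by rewrite /= ltnNge; apply/negP => ln; exact: (nZ n).
have [g gP] := choice Zub.
have sep (p : set nat * set nat) : exists l0, forall l, p.1 != p.2 -> (l0 <= l)%N ->
    subset_code p.1 l != subset_code p.2 l.
  have [->|/eqP ne] := eqVneq p.1 p.2; first by exists 0.
  have [n ne_n] : exists n, p.1 n <> p.2 n.
    by apply/existsNP => e; apply: ne; exact/funext.
  by exists n.+1 => l _; exact: subset_code_neq.
have [N NP] := choice sep.
(* From [n0] on, distinct members of [s] have distinct codes. *)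
pose n0 := \max_(p <- [seq (b, b') | b <- s, b' <- s]) N p.
have n0P b b' l : b \in s -> b' \in s -> (n0 <= l)%N ->
    subset_code b l = subset_code b' l -> b = b'.
  move=> bs b's n0l /eqP; apply: contraTeq => /(NP (b, b')); apply.
  by apply: leq_trans n0l; rewrite /n0 (big_rem (b, b')) ?allpairs_f //= leq_maxl.
pose fix row i := if i is j.+1 then g (row j).+1 else g n0.
have rowZ i : Z (row i) by case: i => [|i]; exact: (gP _).1.
have row_incr : {homo row : i j / (i < j)%N}.
  by apply: homo_ltn => [y x z|i]; [exact: ltn_trans | exact: (gP _).2].
have n0row i : (n0 <= row i)%N.
  by elim: i => [|i IHi]; [exact: (gP _).2 | exact: leq_trans IHi (ltnW (gP _).2)].
pose n := size s; pose rho (i : 'I_n) := row i.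
(* The code is taken at [row n], later than all the rows used, so that it reduces to the right code
   in each of them. *)
pose gam (j : 'I_n) := subset_code (nth set0 s j) (row n).
have gamE i j : (gam j %% 2 ^ rho i)%N = subset_code (nth set0 s j) (rho i).
  by apply: subset_code_mod; apply: ltnW; exact: row_incr.
have /mulmx_max_ideal : \det (code_mx c rho gam) \is a GRing.unit.
  apply: unit_mx => [i j|i j j']; first exact: row_incr.
  rewrite !gamE => codes_eq.
  have e := n0P _ _ _ (mem_nth _ (ltn_ord j)) (mem_nth _ (ltn_ord j')) (n0row i) codes_eq.
  by apply/val_inj/eqP; rewrite -(nth_uniq set0 (ltn_ord j) (ltn_ord j') us) e.
move=> /(_ (\col_j d (nth set0 s j))) dm.
have ia : (index a s < n)%N by rewrite index_mem.
have /dm/(_ (Ordinal ia)) : forall i,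
    (code_mx c rho gam *m \col_j d (nth set0 s j)) i 0 \in m.
  move=> i; have := rowZ i; rewrite /Z /= (big_nth set0) big_mkord mxE.
  by congr (_ \in m); apply: eq_bigr => j _; rewrite !mxE gamE mulrC.
by rewrite mxE /= nth_index // max_idealE uda.
Qed.

End LocalRing.

(** * Homomorphisms on direct products *)

Section AlgebraHom.
Variable R : comNzRingType.

Lemma amulZ (A : nalgType R) (r s : R) (x y : A) :
  amul (r *: x) (s *: y) = (r * s) *: amul x y.
Proof.
rewrite -[r *: x]addr0 amulPl amul0x addr0 -[s *: y]addr0 amulPr amulx0 addr0.
by rewrite scalerA.
Qed.

Section NAlgHomTheory.
Variables (A B : nalgType R) (f : nalgHom A B).

Lemma nalgHom0 : f 0 = 0. Proof. exact: linear0. Qed.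
Lemma nalgHomD : {morph f : x y / x + y}. Proof. exact: linearD. Qed.
Lemma nalgHomZ r : {morph f : x / r *: x}. Proof. exact: linearZ. Qed.

End NAlgHomTheory.

Lemma nalgHom_intro (A B : nalgType R) (g : A -> B) :
  linear g -> {morph g : x y / amul x y} ->
  exists h : nalgHom A B, forall x, h x = g x.
Proof.
move=> g_lin g_mul.
pose g_linear := GRing.isLinear.Build R A B *:%R g g_lin.
pose g_amul := isAmulMorphism.Build R A B g g_mul.
by exists (HB.pack_for (nalgHom A B) g g_linear g_amul).
Qed.

Lemma nalgHom_factor (A C B : nalgType R) (p : A -> C) (h : A -> B) :
  linear p -> {morph p : x y / amul x y} -> (forall c, exists x, p x = c) ->
  linear h -> {morph h : x y / amul x y} -> (forall x, p x = 0 -> h x = 0) ->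
  exists g : nalgHom C B, forall x, h x = g (p x).
Proof.
move=> p_lin p_mul p_surj h_lin h_mul ker; have [l lK] := choice p_surj.
have pB := zmod_morphism_linear p_lin; have hB := zmod_morphism_linear h_lin.
have lp x : h (l (p x)) = h x.
  by apply/eqP; rewrite -subr_eq0 -hB; apply/eqP/ker; rewrite pB lK subrr.
have [g gE] : exists g : nalgHom C B, forall x, g x = h (l x).
  apply: nalgHom_intro => [r x y|x y]; rewrite -[in LHS](lK x) -[in LHS](lK y).
    by rewrite -p_lin lp h_lin.
  by rewrite -p_mul lp h_mul.
by exists g => x; rewrite gE lp.
Qed.

End AlgebraHom.

(** * Coordinatewise scalars and cuts *)

Section Coordinates.
Variables (R : comNzRingType) (I : Type) (A : I -> nalgType R).
Implicit Types (x y : aprod A) (u v : I -> R) (J K : set I).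

Definition act u x : aprod A := fun i => u i *: x i.
Definition cut J : aprod A -> aprod A := act (fun i => (`[< J i >])%:R).

Lemma aprodP x y : (forall i, x i = y i) -> x = y.
Proof. exact: functional_extensionality_dep. Qed.

Lemma aprodD x y i : (x + y) i = x i + y i. Proof. by []. Qed.
Lemma aprodZ r x i : (r *: x) i = r *: x i. Proof. by []. Qed.
Lemma aprodM x y i : amul x y i = amul (x i) (y i). Proof. by []. Qed.

Lemma aprod_sum (L : Type) (s : seq L) (F : L -> aprod A) i :
  (\sum_(a <- s) F a) i = \sum_(a <- s) F a i.
Proof. by elim: s => [|a s IHs]; rewrite ?big_nil // !big_cons aprodD IHs. Qed.

Lemma amul_act u v x y : amul (act u x) (act v y) = act (fun i => u i * v i) (amul x y).
Proof. by apply: aprodP => i; rewrite aprodM amulZ. Qed.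

Lemma cutE J x i : cut J x i = if `[< J i >] then x i else 0.
Proof.
by rewrite /cut /act; case: `[< _ >]; rewrite ?scale1r ?scale0r.
Qed.

Lemma cut_in J x i : J i -> cut J x i = x i.
Proof. by rewrite cutE; case: asboolP. Qed.

Lemma cut_notin J x i : ~ J i -> cut J x i = 0.
Proof. by rewrite cutE; case: asboolP. Qed.

Lemma cut_linear J : linear (cut J).
Proof.
move=> r x y; apply: aprodP => i; rewrite aprodD aprodZ !cutE.
by case: asboolP => _ //; rewrite scaler0 addr0.
Qed.

Lemma cut_amul J : {morph cut J : x y / amul x y}.
Proof.
move=> x y; apply: aprodP => i; rewrite aprodM !cutE.
by case: asboolP => _; rewrite ?amul0x.
Qed.

Lemma amul_cut J x y : amul x (cut J y) = cut J (amul x y).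
Proof.
apply: aprodP => i; rewrite aprodM !cutE.
by case: asboolP => _; rewrite ?amulx0.
Qed.

Lemma cut_amull J x y : amul (cut J x) y = cut J (amul x y).
Proof.
apply: aprodP => i; rewrite aprodM !cutE.
by case: asboolP => _; rewrite ?amul0x.
Qed.

Lemma cut_cut J K x : cut J (cut K x) = cut (J `&` K) x.
Proof.
apply: aprodP => i; rewrite !cutE -[(J `&` K) i]/(J i /\ K i) asbool_and.
by case: `[< J i >]; case: `[< K i >].
Qed.

Lemma cut_setC J x : x = cut J x + cut (~` J) x.
Proof.
apply: aprodP => i; rewrite aprodD !cutE -[(~` J) i]/(~ J i) asbool_neg.
by case: `[< J i >]; rewrite ?addr0 ?add0r.
Qed.

End Coordinates.

Arguments cut {R I A} J x.
Arguments act {R I A} u x.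

(** * Null sets of a homomorphism *)

Section NullSets.
Variables (R : comNzRingType) (I : Type) (A : I -> nalgType R) (B : nalgType R).
Variable f : nalgHom (aprod A) B.
Implicit Types (J K : set I).

Definition null J := forall a b, f (cut J (amul a b)) = 0.

Lemma null0 : null set0.
Proof.
move=> a b; rewrite (_ : cut _ _ = 0) ?nalgHom0 //.
by apply: aprodP => i; rewrite cut_notin.
Qed.

Lemma nullS J K : J `<=` K -> null K -> null J.
Proof.
move=> JK nK a b; rewrite -(nK a (cut J b)) amul_cut cut_cut.
by rewrite setIC (setIidl JK).
Qed.

Lemma nullU J K : null J -> null K -> null (J `|` K).
Proof.
move=> nJ nK a b; rewrite [cut _ _](cut_setC J) nalgHomD !cut_cut.
rewrite (_ : f _ = 0) ?add0r; last by apply: nullS nJ a b => i [].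
by apply: nullS nK a b => i [nJi []].
Qed.

Lemma null_bigcup (T : Type) (F : set T) (J : T -> set I) :
  finite_set F -> (forall t, F t -> null (J t)) -> null (\bigcup_(t in F) J t).
Proof.
(* Classically every type has decidable equality, so [F] can be listed. *)
elim/Peq : T => T in F J *; move=> /finite_seqP[s ->].
elim: s => [|t s IHs] sJ.
  by apply: nullS null0 => i [].
apply: (@nullS _ (J t `|` \bigcup_(t in [set` s]) J t)).
  by move=> i [t' /=]; rewrite inE => /orP[/eqP ->|ts] Ji; [left|right; exists t'].
apply: nullU; first by apply: sJ; rewrite /= mem_head.
by apply: IHs => t' ts; apply: sJ; rewrite /= inE ts orbT.
Qed.

Hypothesis f_surj : forall b : B, exists a : aprod A, f a = b.

(** By surjectivity it suffices to multiply by some [f b], and then the cut applies to a product. *)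
Lemma null_total_ann J x : null J -> f (cut J x) \in total_ann B.
Proof.
move=> nJ; apply/asboolP => y; have [b <-] := f_surj y.
by rewrite -!amul_morph cut_amull amul_cut.
Qed.

(** The set [F] is chosen before [b], so [b] may later be cut down to a set that depends on [F]. *)
Definition kills_cofinitely (T : Type) :=
  forall (a : aprod A) (iota : I -> T), exists2 F : set T, finite_set F &
    forall b, f (cut [set i | ~ F (iota i)] (amul a b)) = 0.

Variable T : Type.
Hypotheses (T_infinite : infinite_set [set: T]) (killT : kills_cofinitely T).

(** Witnesses of nonnullity glue along the disjoint sets into one pair [a], [b]. With the sets
    labelled by distinct elements of [T], some label avoids the finite set attached to [a], and the
    witness there is killed. *)
Lemma no_disjoint_nonnull (E : nat -> set I) :
  (forall m n i, E m i -> E n i -> m = n) -> exists n, null (E n).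
Proof.
move=> Edisj; apply: contrapT => /forallNP nullE.
have wit n : exists p : aprod A * aprod A, f (cut (E n) (amul p.1 p.2)) <> 0.
  have /existsNP[a /existsNP[b]] := nullE n.
  by exists (a, b).
have [w wP] := choice wit.
(* Points in no [E m] get index 0; the final cut to [E n] discards them. *)
have idxP i : exists n, forall m, E m i -> n = m.
  have [[n En]|nE] := pselect (exists n, E n i).
    by exists n => m; exact: Edisj.
  by exists 0 => m Em; case: nE; exists m.
have [idx idxE] := choice idxP.
have [e inj_e _] := infinite_inj T_infinite.
pose a : aprod A := fun i => (w (idx i)).1 i.
pose b : aprod A := fun i => (w (idx i)).2 i.
have [F finF Fkill] := killT a (e \o idx).
have [n nF] : exists n, ~ F (e n).
  apply/existsNP => allF; apply: infinite_nat; apply: card_le_finite finF.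
  rewrite -(card_le_eql (inj_card_eq (in2W inj_e))).
  by apply: subset_card_le => _ [n _ <-].
apply: (wP n); rewrite -(Fkill (cut (E n) b)) amul_cut cut_cut; congr (f _).
apply: aprodP => i; rewrite !cutE; case: asboolP => En; case: asboolP => EF //.
- by rewrite !aprodM /b /a (idxE _ _ En).
- by case: EF; split=> //=; rewrite (idxE _ _ En).
- by case: EF.
Qed.

(** Let [iota] pick for each point of the union some [J t] containing it. All but finitely many
    fibers are killed together, and the rest lie in a finite union of null sets. *)
Lemma null_bigcupT (J : T -> set I) :
  (forall t, null (J t)) -> null (\bigcup_t J t).
Proof.
move=> nJ a b; have [t0 _] := infinite_setN0 T_infinite.
have iotaP i : exists t, (\bigcup_t J t) i -> J t i.
  have [[t _ Jt]|nJi] := pselect ((\bigcup_t J t) i); first by exists t.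
  by exists t0.
have [iota iotaE] := choice iotaP.
have [F finF Fkill] := killT a iota.
set U := \bigcup_t J t.
rewrite [cut _ _](cut_setC [set i | ~ F (iota i)]) nalgHomD.
rewrite -{1}amul_cut Fkill add0r cut_cut.
apply: nullS (null_bigcup finF (fun t _ => nJ t)) _ _ => i [nFi Ui].
by exists (iota i); [exact: contrapT | exact: iotaE].
Qed.

(** * Atoms modulo null sets and their ultrafilters *)

Definition atom J := ~ null J /\ forall D, D `<=` J -> null D \/ null (J `\` D).

Definition atomic_cover J (s : seq (set I)) :=
  [/\ forall D, D \in s -> atom D /\ D `<=` J,
      forall D D' i, D \in s -> D' \in s -> D i -> D' i -> D = D'
    & null (J `\` \bigcup_(D in [set` s]) D)].

Lemma atomic_coverU D J s t :
  D `<=` J -> atomic_cover D s -> atomic_cover (J `\` D) t ->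
  atomic_cover J (s ++ t).
Proof.
move=> DJ [sD sdisj snull] [tJ tdisj tnull]; split.
- move=> E; rewrite mem_cat => /orP[/sD|/tJ] [aE EJ]; split=> // i /EJ; first exact: DJ.
  by case.
- move=> E E' i; rewrite !mem_cat => /orP[Es|Et] /orP[E's|E't] Ei E'i.
  + exact: sdisj Ei E'i.
  + by case: ((tJ _ E't).2 _ E'i) => _; case; exact: (sD _ Es).2.
  + by case: ((tJ _ Et).2 _ Ei) => _; case; exact: (sD _ E's).2.
  + exact: tdisj Ei E'i.
- apply: nullS (nullU snull tnull) => i [Ji ni].
  have [Di|nDi] := pselect (D i); [left|right]; split=> //.
    by move=> [E Es Ei]; apply: ni; exists E => //; rewrite /= mem_cat (Es : E \in s).
  by move=> [E Et Ei]; apply: ni; exists E => //; rewrite /= mem_cat (Et : E \in t) orbT.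
Qed.

(* A set without an atomic cover splits into two nonnull sets, one of which has
   no atomic cover; iterating gives infinitely many disjoint nonnull sets. *)
Lemma atomic_cover_exists J : exists s, atomic_cover J s.
Proof.
pose bad D := ~ exists s, atomic_cover D s.
apply: contrapT => badJ.
have step (D : {D | bad D}) : exists D' : {D | bad D},
    sval D' `<=` sval D /\ ~ null (sval D `\` sval D').
  case: D => D badD /=.
  have nullD : ~ null D.
    move=> nD; apply: badD; exists [::]; split=> //.
    by apply: nullS nD => i [].
  (* A nonnull [D] that did not split would be an atom and cover itself. *)
  have [E ED [nE nDE]] : exists2 E, E `<=` D & ~ null E /\ ~ null (D `\` E).
    apply: contrapT => nE; apply: badD; exists [:: D]; split.
    - move=> D'; rewrite mem_seq1 => /eqP ->; split=> //; split=> // E ED.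
      by apply: contrapT => /not_orP h; apply: nE; exists E.
    - by move=> D1 D2 i; rewrite !mem_seq1 => /eqP e1 /eqP e2; rewrite e1 e2.
    - by apply: nullS null0 => i [Di]; case; exists D => //=; rewrite mem_seq1.
  have [badE|goodE] := pselect (bad E); first by exists (exist _ E badE).
  have [badDE|goodDE] := pselect (bad (D `\` E)).
    exists (exist _ _ badDE); split=> [i []//|/= nDDE]; apply: nE.
    by apply: nullS nDDE => i Ei; split; [exact: ED | case].
  case/contrapT: goodE => s sE; case/contrapT: goodDE => t tDE.
  by case: badD; exists (s ++ t); exact: atomic_coverU sE tDE.
have [next nextP] := choice step.
pose D n := sval (iter n next (exist _ J badJ)).
have Ddecr m n : (m <= n)%N -> D n `<=` D m.
  move=> /subnK <-; elim: (n - m)%N => [//|l IHl] i; rewrite addSn => Di.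
  by apply: IHl; exact: (nextP _).1 Di.
have [|n] := no_disjoint_nonnull (E := fun n => D n `\` D n.+1).
  have lt_disj m n i : ~ D m.+1 i -> D n i -> (n <= m)%N.
    by move=> nDm Dn; rewrite leqNgt; apply/negP => /Ddecr/(_ _ Dn).
  move=> m n i [Dm nDm] [Dn nDn]; apply/eqP.
  by rewrite eqn_leq (lt_disj n m i) // (lt_disj m n i).
exact: (nextP _).2.
Qed.

Definition atom_filter D : set_system I := [set K | null (D `\` K)].

Lemma atom_filter_filter D : Filter (atom_filter D).
Proof.
split=> [|P Q nP nQ|P Q PQ]; rewrite /atom_filter /=.
- by apply: nullS null0 => i [_]; apply.
- apply: nullS (nullU nP nQ) => i [Di nPQ].
  by have [Pi|nPi] := pselect (P i); [right|left]; split=> // Qi; apply: nPQ.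
- by apply: nullS => i [Di nQi]; split=> // /PQ.
Qed.

Lemma atom_filter_ultra D : atom D -> UltraFilter (atom_filter D).
Proof.
move=> [nD Dsplit]; apply: ultra_intro; first exact: atom_filter_filter.
  by rewrite /atom_filter /= setD0.
move=> K; have DKD : D `\` K `<=` D by move=> i [].
case: (Dsplit _ DKD) => [nDK|nDDK]; first by left.
by right; apply: nullS nDDK => i [Di nnK]; split=> // -[_ nK]; exact: nnK nK.
Qed.

(** The part of [D] missed by the intersection is the union of the null parts missed by its members,
    reindexed by [T] through an injection. *)
Lemma atom_filter_complete D : succ_complete T (atom_filter D).
Proof.
move=> S SD /card_le_inj[g inj_g]; rewrite /atom_filter /=.
pose J t := \bigcup_(K in [set K : set_type S | val (g K) = t]) (D `\` val K).
apply: (@nullS _ (\bigcup_t J t)).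
  move=> i [Di /existsNP[K /not_implyP[SK nKi]]].
  by exists (val (g (SigSub (mem_set SK)))) => //; exists (SigSub (mem_set SK)).
apply: null_bigcupT => t.
have [[K gK]|nK] := pselect (exists K : set_type S, val (g K) = t); last first.
  by apply: nullS null0 => i [K gK]; case: nK; exists K.
apply: (@nullS _ (D `\` val K)); last exact: SD (set_valP K).
by move=> i [K' /= gK']; rewrite -gK in gK'; rewrite (inj_g _ _ (val_inj gK')).
Qed.

(** * Factorizations *)

Lemma total_ann_of_null J x : null J -> (forall i, ~ J i -> x i = 0) ->
  f x \in total_ann B.
Proof.
move=> nJ x0; rewrite (_ : x = cut J x); first exact: null_total_ann.
apply: aprodP => i; have [Ji|nJi] := pselect (J i); first by rewrite cut_in.
by rewrite cut_notin ?x0.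
Qed.

Lemma nalg_proj_comp_linear : linear (fun x => nalg_proj (total_ann B) (f x)).
Proof. by move=> r x y; rewrite nalgHomD nalgHomZ nalg_proj_linear. Qed.

Lemma nalg_proj_comp_amul :
  {morph (fun x => nalg_proj (total_ann B) (f x)) : x y / amul x y}.
Proof. by move=> x y /=; rewrite amul_morph nalg_proj_amul. Qed.

Lemma nalg_proj_comp0 x :
  f x \in total_ann B -> nalg_proj (total_ann B) (f x) = 0.
Proof.
move=> fx; rewrite -(nalgHom0 (nalg_proj (total_ann B))).
by apply/nalg_projP; rewrite subr0.
Qed.

(** Representatives glue over the disjoint atoms, so the map to the product of reduced products is
    onto. An element of its kernel is supported on a null set, hence [f] sends it into the
    annihilator. *)
Lemma factors_ultra_of_cover s : atomic_cover setT s -> uniq s ->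
  factors_ultra f T.
Proof.
move=> [s_atom s_disj s_null] us.
pose D (m : 'I_(size s)) := nth set0 s m.
have Ds m : D m \in s by exact: mem_nth.
have Ddisj m m' i : D m i -> D m' i -> m = m'.
  move=> Dmi Dm'i; apply/val_inj/eqP.
  rewrite -(nth_uniq set0 (ltn_ord m) (ltn_ord m') us); apply/eqP.
  exact: s_disj (Ds m) (Ds m') Dmi Dm'i.
pose U m := FilterType (atom_filter (D m)) (atom_filter_filter (D m)).
exists (size s), U; split=> [m|].
  by split; [exact: atom_filter_ultra (s_atom _ (Ds m)).1 | exact: atom_filter_complete].
apply: (nalgHom_factor (p := fun x : aprod A =>
    (fun m => redprod_proj (U m) x) : aprod (fun m => redprod A (U m)))).
- by move=> r x y; apply: aprodP => m; exact: nalg_proj_linear.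
- by move=> x y; apply: aprodP => m; exact: nalg_proj_amul.
- move=> q.
  have xP i : exists y : A i, forall m, D m i -> y = (repr (q m) : aprod A) i.
    have [[m Dm]|nD] := pselect (exists m, D m i); last first.
      by exists 0 => m Dm; case: nD; exists m.
    by exists ((repr (q m) : aprod A) i) => m' /(Ddisj _ _ _ Dm) ->.
  exists (fun i => sval (cid (xP i))); apply: aprodP => m.
  rewrite -[RHS](@nalg_projK _ _ (@null_mod R I A (U m))); apply/redprod_projP.
  apply: nullS null0 => i [Dm] /=; apply.
  exact: (svalP (cid (xP i))).
- exact: nalg_proj_comp_linear.
- exact: nalg_proj_comp_amul.
move=> x px0; apply: nalg_proj_comp0.
have x0 m : null (D m `\` [set i | x i = 0]).
  have /redprod_projP : redprod_proj (U m) x = redprod_proj (U m) 0.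
    rewrite [RHS](nalgHom0 (nalg_proj (@null_mod R I A (U m)))).
    exact: (congr1 (fun y : aprod (fun m => redprod A (U m)) => y m) px0).
  by [].
apply: (@total_ann_of_null (\bigcup_(m in [set: 'I_(size s)]) (D m `\` [set i | x i = 0])
    `|` ([set: I] `\` \bigcup_(E in [set` s]) E))).
  by apply: nullU => //; apply: null_bigcup; [exact: finite_finset | by []].
move=> i ni; apply: contrapT => xi; apply: ni.
have [[E Es Ei]|nE] := pselect ((\bigcup_(E in [set` s]) E) i); last by right.
left; have Em : (index E s < size s)%N by rewrite index_mem.
by exists (Ordinal Em) => //; split=> //; rewrite /D /= nth_index.
Qed.

(** The map [f] is the sum of its composites with the cuts to [D] and to its complement; the latter
    lands in the annihilator. *)
Lemma factors_finite_of_null (D : set I) :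
  finite_set D -> null (~` D) -> factors_finite f.
Proof.
move=> Dfin nD; exists D; split=> //.
have restr_lin : linear (restr D : aprod A -> _) by [].
have restr_mul : {morph (restr D : aprod A -> _) : x y / amul x y} by [].
have restr_surj (y : aprod (fun i : set_type D => A (set_val i))) :
    exists x : aprod A, restr D x = y.
  (* The value at [i] must not depend on the proof that [i] is in [D]. *)
  have xP i : exists z : A i, forall h : i \in D, z = y (SigSub h).
    have [iD|niD] := pselect (i \in D); last by exists 0.
    by exists (y (SigSub iD)) => h; congr (y (SigSub _)); exact: bool_irrelevance.
  exists (fun i => sval (cid (xP i))); apply: aprodP => -[i iD].
  exact: (svalP (cid (xP i))).
have restr0 (x : aprod A) : restr D x = 0 -> forall i, D i -> x i = 0.
  by move=> x0 i Di; have /(congr1 (fun y => y (SigSub (mem_set Di)))) := x0.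
split.
  apply: nalgHom_factor => //.
  - exact: nalg_proj_comp_linear.
  - exact: nalg_proj_comp_amul.
  move=> x /restr0 x0; apply: nalg_proj_comp0; apply: total_ann_of_null nD _ => i Di.
  by apply: x0; exact: contrapT.
have cut_hom J : exists g : nalgHom (aprod A) B, forall x, g x = f (cut J x).
  apply: nalgHom_intro => [r x y|x y]; first by rewrite cut_linear nalgHomD nalgHomZ.
  by rewrite cut_amul amul_morph.
have [f1 f1E] := cut_hom D; have [f0 f0E] := cut_hom (~` D).
exists f1, f0; split=> [x||x].
- by rewrite f1E f0E -nalgHomD -cut_setC.
- apply: nalgHom_factor => //.
  + by move=> r x y; rewrite nalgHomD nalgHomZ.
  + by move=> x y; rewrite amul_morph.
  move=> x /restr0 x0; rewrite f1E (_ : cut D x = 0) ?nalgHom0 //.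
  apply: aprodP => i; have [Di|nDi] := pselect (D i); last by rewrite cut_notin.
  by rewrite cut_in ?x0.
- by rewrite f0E; exact: null_total_ann.
Qed.

Lemma factors_of_kills :
  factors_ultra f T /\ (below_measurables I T -> factors_finite f).
Proof.
have [t tcover] := atomic_cover_exists setT.
have [s us scover] : exists2 s, uniq s & atomic_cover setT s.
  exists (undup t); first exact: undup_uniq.
  have memE := mem_undup t; have [t_atom t_disj t_null] := tcover; split.
  - by move=> D; rewrite memE; exact: t_atom.
  - by move=> D D' i; rewrite !memE; exact: t_disj.
  - apply: nullS t_null => i [_ ni]; split=> // -[D Dt Di].
    by apply: ni; exists D; rewrite //= memE.
split=> [|Ismall]; first exact: factors_ultra_of_cover scover us.
have [s_atom _ s_null] := scover.
(* That the ultrafilter of [D] is principal at [i] makes [D] without [i] null. The option type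
   handles sets off [s] even when [I] is empty. *)
have pP D : exists o : option I, D \in s -> exists2 i, o = Some i & null (D `\` [set i]).
  have [/s_atom[aD _]|_] := boolP (D \in s); last by exists None.
  have [i eD] := succ_complete_principal T_infinite (atom_filter_ultra aD)
    (@atom_filter_complete D) Ismall.
  exists (Some i) => _; exists i => //.
  by have : [set J : set I | J i] [set i] by []; rewrite -eD.
have [p pE] := choice pP.
apply: (@factors_finite_of_null (\bigcup_(D in [set` s]) [set i | p D = Some i])).
  apply: bigcup_finite => [|D _]; first exact: finite_seq.
  case: (p D) => [i|]; last by apply: sub_finite_set (finite_set0 _) => j.
  by apply: sub_finite_set (finite_set1 i) => j [].
apply: nullS (nullU (null_bigcup (J := fun D => D `\` [set i | p D = Some i])
    (finite_seq s) _) s_null) => [i ni|D /pE[i pD]]; last first.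
  by apply: nullS => j [Dj nj]; split=> // ji; apply: nj; rewrite ji.
have [[D Ds Di]|nD] := pselect ((\bigcup_(D in [set` s]) D) i); last by right.
by left; exists D => //; split=> // pDi; apply: ni; exists D.
Qed.

End NullSets.

(* A unit-coefficient relation among the [f (act (x l \o iota) a)] provides a
   scalar family [u], invertible off a finite set, with [f (act u a) = 0]; then
   [cut _ (amul a b)] factors as [amul (act u a) (act u^-1 b)]. *)
Lemma generic_family_kills (R : valRingType) (I : Type) (A : I -> nalgType R)
    (B : nalgType R) (f : nalgHom (aprod A) B) (T : Type) (L : eqType)
    (x : L -> T -> R) :
  torsion_free B -> ~~ ([set: L] #<= rank_set B) -> generic_family x ->
  kills_cofinitely f T.
Proof.
move=> B_tf rkL x_gen a iota.
have [s [d [us sum0 d_unit]]] :=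
  family_unit_dependent (fun l => f (act (x l \o iota) a)) B_tf rkL.
pose w t := \sum_(l <- s) d l * x l t.
exists [set t | w t \in @max_ideal R]; first exact: x_gen.
move=> b; set J := [set i | _].
have fa0 : f (act (w \o iota) a) = 0.
  rewrite -[RHS]sum0 (_ : act _ a = \sum_(l <- s) d l *: act (x l \o iota) a).
    elim: (s) => [|l s' IHs]; first by rewrite !big_nil nalgHom0.
    by rewrite !big_cons nalgHomD nalgHomZ IHs.
  apply: aprodP => i; rewrite aprod_sum /act /= scaler_suml.
  by apply: eq_bigr => l _; rewrite aprodZ scalerA.
rewrite (_ : cut J _ = amul (act (w \o iota) a)
                            (act (fun i => (w (iota i))^-1) (cut J b))).
  by rewrite amul_morph fa0 amul0x.
apply: aprodP => i; rewrite amul_act amul_cut /act.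
have [Ji|nJi] := pselect (J i); last by rewrite !cut_notin ?scaler0.
rewrite divrr ?scale1r //.
by have /negP := Ji; rewrite max_idealE negbK.
Qed.

Theorem theorem9 (R : valRingType)
    (k_infinite : infinite_set [set: residue_field R])
    (I : Type) (A : I -> nalgType R) (B : nalgType R)
    (f : nalgHom (aprod A) B)
    (f_surj : forall b : B, exists a : aprod A, f a = b)
    (B_tf : torsion_free B) :
  (rank_set B #< [set: residue_field R] ->
     factors_ultra f (residue_field R) /\
     (below_measurables I (residue_field R) -> factors_finite f)) /\
  (rank_set B #< [set: set nat] ->
     factors_ultra f nat /\
     (below_measurables I nat -> factors_finite f)).
Proof.
split=> /andP[_ rk].
  apply: factors_of_kills => //.
  exact: generic_family_kills B_tf rk (@generic_fractions R).
have [x x_gen] := generic_codes k_infinite.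
apply: factors_of_kills => //; first exact: infinite_nat.
exact: generic_family_kills B_tf rk x_gen.
Qed.
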